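(* Consider the problem $\min_{x\in\mathbb{R}^n} f(x)+\sum_{i=1}^n g_i(x_i)$, where $f:\mathbb{R}^n\to\mathbb{R}$ is convex with $L$-Lipschitz continuous gradient ($L>0$) and each $g_i:\mathbb{R}\to\mathbb{R}\cup\{+\infty\}$ is a proper, lower semi-continuous, convex function (not necessarily smooth) whose subdifferential is nonempty at every point of its domain. Let $(x^k)$ be generated by the coordinate-wise proximal-gradient iteration with step-size $1/L$ (with any rule for selecting the coordinates). Assume that $x^k\to x^*$ as $k\to\infty$ for an optimal solution $x^*$ of the problem, and that $x^*$ is a nondegenerate solution. Then there exists a finite $k$ such that $x_i^k=x_i^*$ for all $i\in\mathcal{Z}$.
   Context: Coordinate-wise proximal-gradient iteration with step-size $1/L$: at iteration $k$ a coordinate $i=i_k$ is selected, and $$x_i^{k+1}=\arg\min_{y\in\mathbb{R}}\Big\{\tfrac{L}{2}\big(y-(x_i^k-\tfrac1L\nabla_i f(x^k))\big)^2+g_i(y)\Big\},\qquad x_j^{k+1}=x_j^k\ \text{ for } j\ne i.$$ Subdifferential: $\partial g_i(x_i)=\{v\in\mathbb{R}: g_i(y)\ge g_i(x_i)+v(y-x_i)\text{ for all }y\in\mathrm{dom}(g_i)\}$, an interval of the real line. Active set: $\mathcal{Z}=\{i:\partial g_i(x_i^* )\text{ is not a singleton}\}$. Nondegenerate solution: $x^*$ is nondegenerate if for every $i$: $-\nabla_i f(x^* )=\nabla g_i(x_i^* )$ when $\partial g_i(x_i^* )$ is a singleton (here $\nabla g_i(x_i^* )$ denotes its unique element), and $-\nabla_i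 f(x^* )\in\mathrm{int}\,\partial g_i(x_i^* )$ when $\partial g_i(x_i^* )$ is not a singleton. *)

(* Defs.v *)
From HB Require Import structures.
From mathcomp Require Import all_boot all_order all_algebra.
From mathcomp Require Import all_classical all_reals all_analysis.

Set Implicit Arguments.
Unset Strict Implicit.
Unset Printing Implicit Defensive.

Import Order.TTheory GRing.Theory Num.Theory.
Import numFieldNormedType.Exports.

Local Open Scope classical_set_scope.
Local Open Scope ring_scope.

Section ExtendedRealFunctions.
Variable R : realType.
Implicit Types (h : R -> \bar R) (x v : R).

Definition edom h : set R := [set y | (h y < +oo)%E].

Definition eproper h : Prop := (forall y, (-oo < h y)%E) /\ edom h !=set0.

Definition econvex h : Prop :=
  forall (x y t : R), 0 < t < 1 ->
    (h (t * x + (1 - t) * y)%R <= t%:E * h x + (1 - t)%:E * h y)%E.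

(* Empty when [h] is proper and [x] lies outside the domain of [h]. *)
Definition subdifferential h x : set R :=
  [set v | forall y, edom h y -> (h x + (v * (y - x))%:E <= h y)%E].

End ExtendedRealFunctions.

Definition singleton_set (T : Type) (A : set T) : Prop := exists a, A = [set a].

Definition argmin (R : realType) (T : Type) (phi : T -> \bar R) : set T :=
  [set y | forall z, (phi y <= phi z)%E].

Section Gradient.
Variables (R : realType) (n : nat).

(* The library's norm on ['rV[R]_n] is the sup norm, whereas Lipschitz
   continuity of the gradient is meant for the Euclidean norm. *)
Definition l2norm (v : 'rV[R]_n) : R := Num.sqrt (\sum_(i < n) v ord0 i ^+ 2).

Definition gradient (f : 'rV[R]_n -> R) (x : 'rV[R]_n) : 'rV[R]_n :=
  \row_(i < n) 'D_(delta_mx ord0 i) f x.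

Definition has_lipschitz_gradient (L : R) (f : 'rV[R]_n -> R) : Prop :=
  (forall x, differentiable f x) /\
  (forall x y, l2norm (gradient f x - gradient f y) <= L * l2norm (x - y)).

End Gradient.

Section CompositeProblem.
Variables (R : realType) (n : nat).
Variables (f : 'rV[R]_n -> R) (g : 'I_n -> R -> \bar R).

Definition objective (x : 'rV[R]_n) : \bar R :=
  ((f x)%:E + \sum_(i < n) g i (x ord0 i))%E.

Definition prox_model (L : R) (x : 'rV[R]_n) (i : 'I_n) (y : R) : \bar R :=
  ((L / 2 * (y - (x ord0 i - L^-1 * gradient f x ord0 i)) ^+ 2)%:E + g i y)%E.

(* [sel k] is the coordinate updated at iteration [k]. *)
Definition coordinate_prox_gradient (L : R) (sel : nat -> 'I_n)
    (x : nat -> 'rV[R]_n) : Prop :=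
  forall k,
    argmin (prox_model L (x k) (sel k)) (x k.+1 ord0 (sel k)) /\
    (forall j, j != sel k -> x k.+1 ord0 j = x k ord0 j).

Definition active_set (xstar : 'rV[R]_n) : set 'I_n :=
  [set i | ~ singleton_set (subdifferential (g i) (xstar ord0 i))].

Definition nondegenerate_solution (xstar : 'rV[R]_n) : Prop :=
  forall i,
    (forall v, subdifferential (g i) (xstar ord0 i) = [set v] ->
      - gradient f xstar ord0 i = v) /\
    (~ singleton_set (subdifferential (g i) (xstar ord0 i)) ->
      interior (subdifferential (g i) (xstar ord0 i))
        (- gradient f xstar ord0 i)).

End CompositeProblem.

(* Main.v *)
(* If L (x_i - s_i) - grad_i f(x) is a subgradient of g_i at s_i, then s_i
   is optimal for the strongly convex prox model at x, so a step on i lands on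
   s_i exactly.  As x^k converges to the solution s, this number tends to
   - grad_i f(s), which for an active i is interior to the subdifferential;
   hence every late step on i lands on s_i.  If there is no late step on i,
   then x_i^k is eventually constant, equal to its limit. *)
Require Import Defs.
From HB Require Import structures.
From mathcomp Require Import all_boot all_order all_algebra.
From mathcomp Require Import all_classical all_reals all_analysis.
From mathcomp Require Import ring lra.

Set Implicit Arguments.
Unset Strict Implicit.
Unset Printing Implicit Defensive.

Import Order.TTheory GRing.Theory Num.Theory.
Import numFieldNormedType.Exports.

Local Open Scope classical_set_scope.
Local Open Scope ring_scope.


Section EuclideanNorm.
Variables (R : realType) (n : nat).

Lemma ler_coord_l2norm (v : 'rV[R]_n) (i : 'I_n) : `|v ord0 i| <= l2norm v.
Proof.
rewrite -sqrtr_sqr ler_wsqrtr// (bigD1 i)//= lerDl.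
by apply: sumr_ge0 => j _; exact: sqr_ge0.
Qed.

Lemma l2norm_cvg0 (u : nat -> 'rV[R]_n) (l : 'rV[R]_n) :
  u @ \oo --> l -> l2norm (u k - l) @[k --> \oo] --> (0 : R).
Proof.
(* Rewriting [0] as the norm formula at [l - l] reduces the claim to continuity of the square root
   and termwise limits. *)
move=> ul; have -> : (0 : R) = Num.sqrt (\sum_(i < n) (l ord0 i - l ord0 i) ^+ 2).
  by rewrite big1 ?sqrtr0// => i _; rewrite subrr expr0n.
apply: (continuous_cvg _ (@sqrt_continuous R _)).
apply: (cvg_big (op := +%R)) => [|i _]; first exact: add_continuous.
have ui : (u k - l) ord0 i @[k --> \oo] --> l ord0 i - l ord0 i.
  under eq_fun do rewrite !mxE.
  apply: cvgB; last exact: cvg_cst.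
  exact: (cvg_comp _ _ ul (@coord_continuous R 1 n ord0 i l)).
exact: (cvgM ui ui).
Qed.

End EuclideanNorm.

(** A coordinate of the gradient difference is bounded by its Euclidean norm, so the Lipschitz bound
    squeezes it to [0]. *)
Lemma gradient_coord_cvg (R : realType) (n : nat) (L : R) (f : 'rV[R]_n -> R)
    (u : nat -> 'rV[R]_n) (l : 'rV[R]_n) (i : 'I_n) :
  has_lipschitz_gradient L f -> u @ \oo --> l ->
  gradient f (u k) ord0 i @[k --> \oo] --> gradient f l ord0 i.
Proof.
move=> [_ lip] ul; apply/subr_cvg0; apply: norm_cvg0.
have bnd : \forall k \near \oo,
    0 <= `|gradient f (u k) ord0 i - gradient f l ord0 i| <= L * l2norm (u k - l).
  apply: nearW => k; rewrite normr_ge0/=.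
  have := ler_coord_l2norm (gradient f (u k) - gradient f l) i.
  by rewrite !mxE => /le_trans; exact.
apply: (squeeze_cvgr bnd); first exact: cvg_cst.
by rewrite -[X in _ --> X](mulr0 L); apply: cvgMr; exact: l2norm_cvg0.
Qed.

(** The subgradient inequality at a point of the domain rules out [+oo]; properness rules out
    [-oo]. *)
Lemma subdifferential_fin_num (R : realType) (h : R -> \bar R) (x v : R) :
  eproper h -> subdifferential h x v -> h x \is a fin_num.
Proof.
move=> [hNy [y hy]] /(_ y hy) hv; rewrite fin_numE gt_eqF ?hNy//=.
by move: hv; case: (h x) => // /le_lt_trans /(_ hy).
Qed.

(** Minimality of [y] tested against [z], added to the subgradient inequality at [z] tested at [y],
    leaves only a multiple of [(y - z) ^+ 2]. *)
Lemma prox_unique (R : realType) (h : R -> \bar R) (L u z y : R) :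
  0 < L -> eproper h -> subdifferential h z (L * (u - z)) ->
  argmin (fun w => ((L / 2 * (w - u) ^+ 2)%:E + h w)%E) y -> y = z.
Proof.
move=> L0 hp hz /(_ z) /= yz.
have /fineK hzE := subdifferential_fin_num hp hz.
have [hNy _] := hp.
(* If [h y] were [+oo], the model at [y] would exceed its finite value at [z]. *)
have hy : h y \is a fin_num.
  rewrite fin_numE gt_eqF ?hNy//=; apply: contraPN yz => /eqP ->.
  by rewrite -hzE addey// -EFinD leye_eq.
have /hz : edom h y by rewrite /edom/= ltey_eq hy.
move: yz; rewrite -(fineK hy) -hzE -!EFinD !lee_fin => yz hzy.
(* Uses [(y - u)^2 - (z - u)^2 + 2 (u - z) (y - z) = (y - z)^2]. *)
have : L * (y - z) ^+ 2 <= 0 by nra.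
rewrite pmulr_rle0// => yz0; apply/eqP; rewrite -subr_eq0 -sqrf_eq0.
by rewrite eq_le yz0 sqr_ge0.
Qed.

Section Identification.
Variables (R : realType) (n : nat) (L : R).
Variables (f : 'rV[R]_n -> R) (g : 'I_n -> R -> \bar R).
Variables (sel : nat -> 'I_n) (x : nat -> 'rV[R]_n) (xstar : 'rV[R]_n).
Hypotheses (L_gt0 : 0 < L) (f_lip : has_lipschitz_gradient L f).
Hypotheses (g_proper : forall i, eproper (g i)).
Hypotheses (x_iter : coordinate_prox_gradient f g L sel x).
Hypotheses (x_cvg : x @ \oo --> xstar).

Lemma prox_step_eq (i : 'I_n) (k : nat) : sel k = i ->
  subdifferential (g i) (xstar ord0 i)
    (L * (x k ord0 i - xstar ord0 i) - gradient f (x k) ord0 i) ->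
  x k.+1 ord0 i = xstar ord0 i.
Proof.
move=> <- hk; have [xk _] := x_iter k.
apply: (prox_unique L_gt0 (g_proper _) _ xk).
(* With prox centre [u = x_i - L^-1 * grad_i f(x)], the subgradient [L * (u - s_i)] is the number in
   the hypothesis. *)
rewrite (_ : L * _ = L * (x k ord0 (sel k) - xstar ord0 (sel k)) -
  gradient f (x k) ord0 (sel k))//.
by field; rewrite gt_eqF.
Qed.

Lemma near_prox_step_eq (i : 'I_n) :
  interior (subdifferential (g i) (xstar ord0 i)) (- gradient f xstar ord0 i) ->
  \forall k \near \oo, sel k = i -> x k.+1 ord0 i = xstar ord0 i.
Proof.
move=> int_i.
have cvg_v : L * (x k ord0 i - xstar ord0 i) - gradient f (x k) ord0 i
    @[k --> \oo] --> - gradient f xstar ord0 i.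
  rewrite -[X in _ --> X]add0r -[X in _ --> X + _](mulr0 L).
  apply: cvgB; last exact: gradient_coord_cvg f_lip x_cvg.
  apply: cvgMr; apply/subr_cvg0.
  exact: (cvg_comp _ _ x_cvg (@coord_continuous R 1 n ord0 i xstar)).
(* The interior hypothesis says that the subdifferential is a neighbourhood of the limit in
   [cvg_v]. *)
by near=> k => /prox_step_eq; apply; near: k; exact: cvg_v int_i.
Unshelve. all: by end_near.
Qed.

Lemma near_coord_eq (i : 'I_n) :
  (\forall k \near \oo, sel k = i -> x k.+1 ord0 i = xstar ord0 i) ->
  \forall k \near \oo, x k ord0 i = xstar ord0 i.
Proof.
move=> [N _ stepN].
have stay k : sel k != i -> x k.+1 ord0 i = x k ord0 i.
  by move=> ki; apply: (x_iter k).2; rewrite eq_sym.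
(* The selection rule is arbitrary, so [i] may never be selected from [N] on. *)
have [[K NK sK]|nosel] := pselect (exists2 K, (N <= K)%N & sel K = i).
  (* Step [K] produces iterate [K.+1]; from there each step either lands on the limit again or
     leaves coordinate [i] alone. *)
  exists K.+1 => // k /= /subnKC <-; elim: (k - K.+1)%N => [|m IH].
    by rewrite addn0; exact: stepN.
  rewrite addnS; have [sm|/stay -> //] := eqVneq (sel (K.+1 + m)%N) i.
  apply: stepN => //=; apply: (leq_trans NK); exact: ltnW (leq_addr _ _).
have cstN m : x (N + m)%N ord0 i = x N ord0 i.
  elim: m => [|m IH]; first by rewrite addn0.
  rewrite addnS stay//; apply/eqP => sm; apply: nosel.
  by exists (N + m)%N => //; exact: leq_addr.
exists N => // k /= /subnKC <-; rewrite cstN.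
have xi : x k ord0 i @[k --> \oo] --> xstar ord0 i.
  exact: (cvg_comp _ _ x_cvg (@coord_continuous R 1 n ord0 i xstar)).
apply: (cvg_unique _ _ xi) => //; apply: (cvg_near_cst).
by exists N => // m /= /subnKC <-.
Qed.

End Identification.

Theorem theorem8 (R : realType) (n : nat) (L : R)
    (f : 'rV[R]_n -> R) (g : 'I_n -> R -> \bar R)
    (sel : nat -> 'I_n) (x : nat -> 'rV[R]_n) (xstar : 'rV[R]_n)
    (L_gt0 : 0 < L)
    (f_convex : @convex_function R 'rV[R]_n [set: 'rV[R]_n] f)
    (f_lip : has_lipschitz_gradient L f)
    (g_proper : forall i, eproper (g i))
    (g_lsc : forall i, lower_semicontinuous (g i))
    (g_convex : forall i, econvex (g i))
    (g_subdiff : forall i y, edom (g i) y -> subdifferential (g i) y !=set0)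
    (x_iter : coordinate_prox_gradient f g L sel x)
    (x_cvg : x @ \oo --> xstar)
    (xstar_opt : argmin (objective f g) xstar)
    (xstar_nondeg : nondegenerate_solution f g xstar) :
  exists k : nat, forall i : 'I_n,
    active_set g xstar i -> x k ord0 i = xstar ord0 i.
Proof.
suff [k _ /(_ k (leqnn k)) hk] : \forall k \near \oo, forall i,
    active_set g xstar i -> x k ord0 i = xstar ord0 i by exists k.
(* There are finitely many coordinates, so their thresholds have a common bound. *)
apply: filter_forall => i.
have [act|] := pselect (active_set g xstar i); last by move=> ?; exact: nearW.
have int_i := (xstar_nondeg i).2 act.
have step_i := near_prox_step_eq L_gt0 f_lip g_proper x_iter x_cvg int_i.
have := near_coord_eq x_iter x_cvg step_i; exact: filterS.
Qed.
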